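(* Let $n$ be a positive integer with prime factorisation $n=2^{k_0}p_1^{k_1}\cdots p_r^{k_r}$, where $p_1,\dots,p_r$ are distinct odd primes, $k_0\geq 0$ and $k_1,\dots,k_r\geq 1$. Then \[ t_{\mathrm{aff}}(n)=n-\sum_{\substack{0\leq m_i\leq k_i\\ i=0,\ldots,r}}\frac{\varphi(2^{m_0})\varphi(p_1^{m_1})\cdots\varphi(p_r^{m_r})}{\operatorname{lcm}\{\lambda(2^{m_0}),\varphi(p_1^{m_1}),\ldots,\varphi(p_r^{m_r})\}}. \]
   Context: $S(\mathbb{Z}_n)$ is the set of bijections $\mathbb{Z}_n\to\mathbb{Z}_n$. For $\pi\in S(\mathbb{Z}_n)$, $\mathrm{cyc}(\pi)$ is the number of cycles (including fixed points) of $\pi$, $t(\pi)=n-\mathrm{cyc}(\pi)$, $[\pi]=\{x\mapsto \pi(x+b): b\in\mathbb{Z}_n\}$ and $t([\pi])=\min_{\sigma\in[\pi]}t(\sigma)$. A permutation is affine if it has the form $x\mapsto ax+b$ with $a\in\mathbb{Z}_n^\times$, $b\in\mathbb{Z}_n$, and $t_{\mathrm{aff}}(n)=\max\{t([\pi]):\pi\in S(\mathbb{Z}_n)\text{ affine}\}$. $\varphi$ is Euler's totient function ($\varphi(1)=1$), and $\lambda(2^m)$ is the maximum order of an element of $\mathbb{Z}_{2^m}^\times$: $\lambda(2^m)=\varphi(2^m)$ for $m\leq 2$ and $\lambda(2^m)=\varphi(2^m)/2$ for $m\geq 3$. *)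

(* Defs.v *)
From mathcomp Require Import all_boot all_order all_algebra all_fingroup.
Set Implicit Arguments. Unset Strict Implicit. Unset Printing Implicit Defensive.

(* Z_n is modelled by 'I_n = {0,...,n-1} with arithmetic mod n. *)

Lemma ord_gt0 n (x : 'I_n) : 0 < n.
Proof. exact: leq_ltn_trans (leq0n x) (ltn_ord x). Qed.

Definition addZ n (x b : 'I_n) : 'I_n := Ordinal (ltn_pmod (x + b) (ord_gt0 x)).

Lemma addZ_inj n (b : 'I_n) : injective (fun x => addZ x b).
Proof.
move=> x y /(congr1 val) /= /eqP; rewrite eqn_modDr !modn_small //.
by move/eqP/val_inj.
Qed.

Definition shiftp n (s : {perm 'I_n}) (b : 'I_n) : {perm 'I_n} :=
  perm (inj_comp (@perm_inj _ s) (@addZ_inj n b)).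

(* number of cycles (fixed points included) *)
Definition cyc n (s : {perm 'I_n}) : nat := #|porbits s|.
Definition tperm_n n (s : {perm 'I_n}) : nat := n - cyc s.

(* t([pi]) = min over b in Z_n of t(x |-> pi(x+b)); n is a neutral top since t <= n *)
Definition tclass n (s : {perm 'I_n}) : nat :=
  \big[minn/n]_(b : 'I_n) tperm_n (shiftp s b).

Definition affine n (s : {perm 'I_n}) : bool :=
  [exists a : 'I_n, exists b : 'I_n,
     coprime a n && [forall x : 'I_n, val (s x) == (a * x + b) %% n]].

Definition t_aff n : nat :=
  \max_(s : {perm 'I_n} | affine s) tclass s.

Definition lambda2 (m : nat) : nat :=
  if m <= 2 then totient (2 ^ m) else totient (2 ^ m) %/ 2.

(* Main.v *)
Require Import Defs.
From mathcomp Require Import all_boot all_order all_algebra all_fingroup.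
From mathcomp Require Import ring cyclic pgroup extremal.
Set Implicit Arguments. Unset Strict Implicit. Unset Printing Implicit Defensive.
Import Order.TTheory GRing.Theory Num.Theory.

(* The class of [x |-> a x + b] consists of all [x |-> a x + c]. By Burnside's
   formula the number of cycles of a permutation [g] is the average of the
   numbers of fixed points of its powers, and a power of [x |-> a x + c] has
   either no fixed point or as many as the same power of [x |-> a x]; so the
   minimum over the class is attained at [x |-> a x]. There the orbit of [x] has
   length the order of [a] modulo [d = n / gcd(x, n)], and each [d] arises from
   [totient d] values of [x]. That order divides the exponent of the unit group
   mod [d], and one [a] attains the exponent for all [d] at once: glue by the
   Chinese remainder theorem primitive roots mod [p ^ k] for odd [p], and [3]
   mod [2 ^ k]. *)

(** * Orders of units modulo prime powers *)

(** [S] is the geometric sum of the powers of [a]; each of its [k] terms is 1 mod [p]. *)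
Lemma subn1_exp_mod p a k : a = 1 %[mod p] ->
  exists2 S, a ^ k - 1 = (a - 1) * S & S = k %[mod p].
Proof.
move=> a1; exists (\sum_(i < k) a ^ (k.-1 - i) * 1 ^ i).
  by rewrite -[X in _ - X](exp1n k) subn_exp.
rewrite -modn_summ; under eq_bigr => i _.
  rewrite exp1n muln1 -modnXm a1 modnXm exp1n.
  over.
by rewrite modn_summ sum_nat_const card_ord muln1.
Qed.

(** The cofactor of [a - 1] in [a ^ p - 1] is [p] mod [p], hence supplies one more factor [p]. *)
Lemma expn_p_mod_lift p m a : 0 < m -> 0 < a ->
  a = 1 %[mod p ^ m] -> a ^ p = 1 %[mod p ^ m.+1].
Proof.
move=> m_gt0 a_gt0 /eqP am1; apply/eqP.
rewrite eqn_mod_dvd // in am1; rewrite eqn_mod_dvd ?expn_gt0 ?a_gt0 //.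
have ap1 : a = 1 %[mod p].
  apply/eqP; rewrite eqn_mod_dvd //; apply: dvdn_trans am1.
  by rewrite -(prednK m_gt0) expnS dvdn_mulr.
have [S -> Sp] := subn1_exp_mod p ap1.
by rewrite expnSr dvdn_mul // /dvdn Sp modnn.
Qed.

Lemma expn_px_mod_lift p m j a : 0 < m -> 0 < a ->
  a = 1 %[mod p ^ m] -> a ^ (p ^ j) = 1 %[mod p ^ (m + j)].
Proof.
move=> m_gt0 a_gt0 am1; elim: j => [|j IHj]; first by rewrite addn0.
rewrite expnSr expnM addnS; apply: expn_p_mod_lift => //.
  by rewrite addn_gt0 m_gt0.
by rewrite expn_gt0 a_gt0.
Qed.

(** The automorphism group of a cyclic group of odd prime power order is cyclic; its generator acts
    as multiplication by a primitive root. *)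
Lemma pfactor_primitive_root p k : prime p -> odd p -> 0 < k ->
  exists2 g, coprime g p &
    forall t, g ^ t = 1 %[mod p ^ k] -> totient (p ^ k) %| t.
Proof.
move=> p_pr p_odd k_gt0; set q := p ^ k.
have q_gt1 : 1 < q by rewrite -(exp1n k) ltn_exp2r ?prime_gt1.
pose G := [set: 'Z_q]%G.
have oG : #|G| = q by rewrite cardsT card_ord Zp_cast.
have cycG : cyclic G by apply/cyclicP; exists (Zp1 : 'Z_q); apply: Zp_cycle.
have pG : (p.-group G)%g by rewrite /pgroup oG pnatX pnat_id.
have ntG : (G :!=: 1)%g by rewrite -cardG_gt1 oG.
(* [m] identifies the automorphisms of the additive group [Z/q] with the units
   of the ring [Z/q]. *)
have [m [[_ [m1 _] [m_inj m_im] mX _] [_ cycF _ _] mA]] :=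
  cyclic_pgroup_Aut_structure pG cycG ntG.
(* For [k = 1], [Aut G] equals its cyclic part of order prime to [p]; for larger [k], the odd case
   of the structure theorem applies. *)
have {cycF mA} cycA : cyclic (Aut G).
  case: ifP mA => [_ -> // | _ [t [_ _ _]]].
  by rewrite p_odd; case=> [[]].
have [a defA] := cyclicP cycA.
have Aa : a \in Aut G by rewrite defA cycle_id.
have oA : #|Aut G| = totient q by rewrite card_Aut_cyclic // oG.
have ma_unit : m a \is a GRing.unit by rewrite -m_im; apply: image_f.
clear m_im; move: m m1 m_inj mX ma_unit; rewrite oG => m m1 m_inj mX ma_unit.
exists (m a : nat).
  rewrite coprime_sym -(@coprime_pexpl k) // -/q.
  by rewrite -(natr_Zp (m a)) unitZpE // in ma_unit.
move=> t mat1; rewrite -oA defA -orderE order_dvdn; apply/eqP/m_inj.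
- exact: groupX.
- exact: group1.
rewrite mX // m1 -(natr_Zp (m a)) -GRing.natrX -(Zp_nat_mod q_gt1).
by rewrite mat1 Zp_nat_mod.
Qed.

(** Oddness of [u] makes the 2-adic valuation exact. Squaring raises it by one, starting from
    [3 ^ 2 = 1 + 8]. *)
Lemma expn3_2x j : exists2 u, odd u & 3 ^ (2 ^ j.+1) = 1 + 2 ^ j.+3 * u.
Proof.
elim: j => [|j [u u_odd IHj]]; first by exists 1.
exists (u + 2 ^ j.+2 * u ^ 2); first by rewrite oddD oddM oddX u_odd.
rewrite expnSr expnM IHj !expnS !expn0; ring.
Qed.

Lemma lambda2SSS m : lambda2 m.+3 = 2 ^ m.+1.
Proof. by rewrite /lambda2 /= totient_pfactor //= mul1n expnSr mulnK. Qed.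

Lemma expn3_mod_2x m t : 3 ^ t = 1 %[mod 2 ^ m] -> lambda2 m %| t.
Proof.
case: m => [|[|m]]; rewrite ?dvd1n // => t1.
have t_even : 2 %| t.
  have {t1}: 3 ^ t = 1 %[mod 4].
    apply/eqP; move/eqP: t1; rewrite !eqn_mod_dvd ?expn_gt0 //.
    by apply: dvdn_trans; rewrite (expnD 2 2 m) dvdn_mulr.
  rewrite -(odd_double_half t) -mul2n expnD expnM -modnMmr -modnXm exp1n.
  by rewrite dvdn2 oddD mul2n odd_double addbF oddb; case: (odd t).
case: m t1 => // m t1; rewrite lambda2SSS.
have [->|t_gt0] := posnP t; first by rewrite dvdn0.
have [v [u u_odd tE]] : exists v, exists2 u, odd u & t = 2 ^ v * u.
  have [u] := pfactor_coprime (isT : prime 2) t_gt0.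
  by rewrite coprime2n => u_odd ->; exists (logn 2 t), u; rewrite // mulnC.
case: v tE t1 => [|v] tE; first by rewrite tE mul1n dvdn2 u_odd in t_even.
have [w w_odd E3] := expn3_2x v.
(* [S] has the parity of [u], so raising to the odd power [u] leaves the valuation unchanged. *)
have [|S S3 S_odd] := @subn1_exp_mod 2 (3 ^ 2 ^ v.+1) u.
  by rewrite !modn2 oddX orbT.
rewrite tE expnM => /eqP; rewrite eqn_mod_dvd ?expn_gt0 // S3 E3 addKn => mv.
apply: dvdn_mulr; apply: dvdn_exp2l; rewrite ltnS leqNgt; apply/negP => vm.
have : 2 ^ v.+4 %| 2 ^ v.+3 * w * S by apply: dvdn_trans mv; apply: dvdn_exp2l.
rewrite expnSr -mulnA dvdn_pmul2l ?expn_gt0 // dvdn2 oddM w_odd.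
by have := congr1 odd S_odd; rewrite !modn2 !oddb u_odd => ->.
Qed.

(** For exponents at least 3, start from [a ^ 2 = 1] mod 8 and gain a factor 2 with each
    squaring. *)
Lemma expn_odd_mod_2x a m : odd a -> a ^ lambda2 m = 1 %[mod 2 ^ m].
Proof.
move=> a_odd; have a2 : coprime a 2 by rewrite coprimen2.
case: m => [|[|[|m]]]; try by rewrite ?modn1 // Euler_exp_totient // coprimeXr.
rewrite lambda2SSS expnS expnM; apply: (@expn_px_mod_lift 2 3 m (a ^ 2)) => //.
  by rewrite expn_gt0 odd_gt0.
have : odd (a %% 8) by rewrite odd_mod.
rewrite -modnXm; have := ltn_pmod a (isT : 0 < 8).
by move: (a %% 8); do 8 case=> //.
Qed.

Definition pfactor_lambda p e := if p == 2 then lambda2 e else totient (p ^ e).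

Lemma expn_pfactor_lambda_mod a p e : prime p -> coprime a p ->
  a ^ pfactor_lambda p e = 1 %[mod p ^ e].
Proof.
move=> p_pr co_ap; rewrite /pfactor_lambda; case: eqP co_ap => [-> | _] co_ap.
  by apply: expn_odd_mod_2x; rewrite -coprimen2.
by rewrite Euler_exp_totient // coprimeXr.
Qed.

(** A primitive root mod [p ^ k] serves every [e <= k]: if [g ^ t] is 1 mod [p ^ e], its power
    [p ^ (k - e)] is 1 mod [p ^ k], and this factor cancels from the resulting divisibility. *)
Lemma pfactor_lambda_attained p k : prime p ->
  exists2 g, coprime g p &
    forall e t, e <= k -> g ^ t = 1 %[mod p ^ e] -> pfactor_lambda p e %| t.
Proof.
move=> p_pr; rewrite /pfactor_lambda; case: eqP => [-> | /eqP p2].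
  by exists 3 => // e t _; apply: expn3_mod_2x.
have p_odd : odd p by case: (even_prime p_pr) p2 => // ->.
have [->|k_gt0] := posnP k.
  by exists 1 => [|e t]; rewrite ?coprime1n // leqn0 => /eqP ->.
have [g co_gp g_ord] := pfactor_primitive_root p_pr p_odd k_gt0.
exists g => // -[|e] t e_k gt1; first by rewrite dvd1n.
have g_gt0 : 0 < g.
  case: g co_gp {g_ord gt1} => //; rewrite /coprime gcd0n => /eqP p1.
  by rewrite p1 in p_pr.
have := @expn_px_mod_lift p e.+1 (k - e.+1) (g ^ t) isT _ gt1.
rewrite expn_gt0 g_gt0 subnKC // -expnM => /(_ isT)/g_ord.
rewrite -{1}(subnKC e_k) !totient_pfactor ?addn_gt0 //= expnD mulnA.
by rewrite dvdn_pmul2r // expn_gt0 prime_gt0.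
Qed.

Lemma chinese_primes (r : seq nat) (g k : nat -> nat) :
    all prime r -> uniq r ->
  exists a, forall p, p \in r -> a = g p %[mod p ^ k p].
Proof.
elim: r => [|p r IHr] /=; first by exists 0.
move=> /andP[p_pr r_pr] /andP[pr r_uniq]; have [b bE] := IHr r_pr r_uniq.
pose M := \prod_(q <- r) q ^ k q.
have co_pM : coprime (p ^ k p) M.
  rewrite /M big_seq; apply: (big_ind (coprime (p ^ k p))).
  - by rewrite coprimen1.
  - by move=> x y; rewrite coprimeMr => -> ->.
  move=> q q_r; apply: coprimeXl; apply: coprimeXr.
  have q_pr := allP r_pr q q_r; rewrite prime_coprime // dvdn_prime2 //.
  by apply: contraNN pr => /eqP->.
exists (chinese (p ^ k p) M (g p) b) => q; rewrite inE => /orP[/eqP-> | q_r].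
  exact: chinese_modl.
rewrite -bE //; have q_M : q ^ k q %| M by rewrite /M (big_rem q) //= dvdn_mulr.
by rewrite -(modn_dvdm _ q_M) chinese_modr // modn_dvdm.
Qed.

(** * Counting cycles of a permutation *)

Lemma iter_perm_fix (T : finType) (s : {perm T}) x k :
  (iter k s x == x) = (#|porbit s x| %| k).
Proof.
set o := #|porbit s x|.
have o_gt0 : 0 < o by rewrite lt0n card_porbit_neq0.
have iterM j : iter (j * o) s x = x.
  by elim: j => // j IHj; rewrite mulSn iterD IHj iter_porbit.
rewrite {1}(divn_eq k o) addnC iterD iterM.
have r_lt := ltn_pmod k o_gt0; rewrite /dvdn.
have := nth_uniq x _ _ (uniq_traject_porbit s x).
rewrite size_traject => /(_ (k %% o) 0 r_lt o_gt0).
by rewrite !nth_traject.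
Qed.

(** The reciprocals of the orbit lengths sum to 1 over each orbit. *)
Lemma card_porbits_sum (T : finType) (s : {perm T}) :
  (#|porbits s|%:R = \sum_(x : T) (#|porbit s x|%:R)^-1 :> rat)%R.
Proof.
rewrite (partition_big_imset (porbit s)) /= -[LHS]sumr_const -/(porbits s).
apply: eq_bigr => A /imsetP[y _ ->].
rewrite (eq_bigl [in porbit s y]); last by move=> x /=; rewrite eq_porbit_mem.
rewrite (eq_bigr (fun=> (#|porbit s y|%:R)^-1)%R); last first.
  by move=> x; rewrite -eq_porbit_mem => /eqP ->.
by rewrite sumr_const -[RHS]mulr_natl divff // pnatr_eq0 card_porbit_neq0.
Qed.

Lemma sum_dvdn_ord o N : o %| N -> \sum_(k < N) (o %| k) = N %/ o.
Proof.
move=> o_N; rewrite -(big_mkord xpredT (fun k => (o %| k) : nat)).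
rewrite divn_count_dvd; apply: (@addIn (o %| N)).
by rewrite -big_nat_recr //= big_ltn // dvdn0 o_N addnC.
Qed.

(** Double counting of the pairs [(k, x)] with [x] fixed by the [k]-th iterate: each [x] lies in [N]
    divided by its orbit length many. *)
Lemma porbits_burnside (T : finType) (s : {perm T}) N : (s ^+ N = 1)%g ->
  #|porbits s| * N = \sum_(k < N) #|[pred x | iter k s x == x]|.
Proof.
move=> sN1.
transitivity (\sum_(x : T) N %/ #|porbit s x|); last first.
  under [RHS]eq_bigr => k _ do rewrite -sum1_card big_mkcond /=.
  rewrite exchange_big; apply: eq_bigr => x _ /=.
  rewrite -sum_dvdn_ord; last by rewrite -iter_perm_fix -permX sN1 perm1.
  by apply: eq_bigr => k _; rewrite inE iter_perm_fix; case: (_ %| _).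
apply/eqP; rewrite -(eqr_nat rat) natrM natr_sum card_porbits_sum mulr_suml.
apply/eqP/eq_bigr => x _; rewrite natf_div 1?mulrC //.
by rewrite -iter_perm_fix -permX sN1 perm1.
Qed.

(** * Affine against linear permutations *)

(** Differences of points are multiplied by [a] at each step; the terms are moved across to avoid
    subtraction. *)
Lemma iter_affine n a (s : {perm 'I_n}) c :
    (forall x, val (s x) = (a * x + c) %% n) ->
  forall k (x y : 'I_n),
    iter k s x + a ^ k * y = iter k s y + a ^ k * x %[mod n].
Proof.
move=> sE; elim=> [|k IHk] x y; first by rewrite !mul1n addnC.
rewrite !iterS !sE !expnS -!mulnA !modnDml !(addnAC _ c) -!mulnDr.
by rewrite -modnDml -modnMmr IHk modnMmr modnDml.
Qed.

Lemma iter_linear n a (s : {perm 'I_n}) :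
    (forall x, val (s x) = (a * x) %% n) ->
  forall k (x : 'I_n), val (iter k s x) = (a ^ k * x) %% n.
Proof.
move=> sE; elim=> [|k IHk] x; first by rewrite mul1n modn_small.
by rewrite iterS sE IHk modnMmr mulnA -expnS.
Qed.

(* When an iterate of [x |-> a x + c] has a fixed point [y], translation by
   [- y] embeds its fixed points into those of the same iterate of
   [x |-> a x]. *)
Lemma leq_cyc_affine_linear n a (s s0 : {perm 'I_n}) c :
    (forall x, val (s x) = (a * x + c) %% n) ->
    (forall x, val (s0 x) = (a * x) %% n) ->
  cyc s <= cyc s0.
Proof.
(* A common multiple of both orders makes the two Burnside sums comparable term by term. *)
move=> sE s0E; pose N := (#[s]%g * #[s0]%g)%N.
have sN : (s ^+ N = 1)%g by rewrite /N expgM expg_order expg1n.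
have s0N : (s0 ^+ N = 1)%g by rewrite /N mulnC expgM expg_order expg1n.
rewrite -(@leq_pmul2r N) ?muln_gt0 ?order_gt0 // /cyc !porbits_burnside //.
apply: leq_sum => k _.
case: (pickP [pred x | iter k s x == x]) => [y /eqP /= y_fix | noF]; last first.
  by rewrite eq_card0.
have n_gt0 := ord_gt0 y.
pose my : 'I_n := Ordinal (ltn_pmod (n - y) n_gt0).
rewrite -(card_image (@addZ_inj n my)).
apply: subset_leq_card; apply/subsetP => z /imageP[x /eqP /= x_fix ->].
rewrite inE -val_eqE /= (iter_linear s0E) /=.
have := iter_affine sE k x y; rewrite x_fix y_fix => xy.
set w := (n - y) %% n.
have wy : w + y = 0 %[mod n] by rewrite modnDml subnK ?modnn ?mod0n // ltnW.
have aky : a ^ k * w + a ^ k * y = 0 %[mod n].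
  by rewrite -mulnDr -modnMmr wy mod0n muln0 mod0n.
(* Adding [y + a ^ k * y] to both sides cancels the translation [w] and leaves [xy]. *)
rewrite modnMmr -(eqn_modDr (y + a ^ k * y)) mulnDr addnA (addnAC (a ^ k * x)).
rewrite -addnA -modnDmr aky modnDmr addn0 addnC -xy.
by rewrite (addnC y) addnACA -[X in _ == X]modnDmr wy modnDmr addn0.
Qed.

(** * Classifying residues by their gcd with [n] *)

Lemma eqn_mod_mul2r n x a b : 0 < n ->
  (a * x == b * x %[mod n]) = (a == b %[mod n %/ gcdn x n]).
Proof.
move=> n_gt0; wlog ba : a b / b <= a => [hwlog|].
  have [/hwlog // | /ltnW/hwlog] := leqP b a.
  by rewrite eq_sym => ->; rewrite eq_sym.
rewrite !eqn_mod_dvd ?leq_mul // -mulnBl; set g := gcdn x n.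
have g_gt0 : 0 < g by rewrite gcdn_gt0 n_gt0 orbT.
have nE : n = n %/ g * g by rewrite divnK // dvdn_gcdr.
have xE : x = x %/ g * g by rewrite divnK // dvdn_gcdl.
rewrite {1}nE {1}xE mulnA dvdn_pmul2r // Gauss_dvdl // coprime_sym.
by rewrite /coprime -(eqn_pmul2r g_gt0) muln_gcdl -nE -xE mul1n.
Qed.

(** These [x] are the multiples [e * y] of [e = n / d] with [y < d] coprime to [d]. *)
Lemma card_ord_gcdn n d : 0 < n -> d %| n ->
  #|[pred x : 'I_n | n %/ gcdn x n == d]| = totient d.
Proof.
move=> n_gt0 d_n; pose e := n %/ d.
have nE : n = e * d by rewrite /e divnK.
have [e_gt0 d_gt0] : 0 < e /\ 0 < d by apply/andP; rewrite -muln_gt0 -nE.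
have h_lt (y : 'I_d) : e * y < n by rewrite nE ltn_pmul2l.
pose h y := Ordinal (h_lt y).
have h_inj : injective h.
  by move=> y z /(congr1 val)/eqP /=; rewrite eqn_pmul2l // => /eqP/val_inj.
have -> : totient d = #|[pred y : 'I_d | coprime d y]|.
  rewrite totient_count_coprime big_mkord -sum1_card [RHS]big_mkcond /=.
  by apply: eq_bigr => y _; rewrite inE; case: coprime.
rewrite -(card_image h_inj); apply: eq_card => x.
rewrite inE; apply/idP/imageP => [/eqP xd | [y co_dy ->]] /=; last first.
  by rewrite nE -muln_gcdr gcdnC (eqP (co_dy : coprime d y)) muln1 mulKn.
have gE : gcdn x n = e.
  by have g_n := dvdn_gcdr x n; rewrite /e -xd divnA // mulnC mulnK.
have xE : x = e * (x %/ e) :> nat by rewrite mulnC divnK // -gE dvdn_gcdl.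
have y_lt : x %/ e < d by rewrite ltn_divLR // mulnC -nE.
exists (Ordinal y_lt); last exact: val_inj.
rewrite inE /coprime -(eqn_pmul2l e_gt0) muln_gcdr /= -xE -nE.
by rewrite gcdnC gE muln1.
Qed.

Lemma sum_ord_gcdn n (f : nat -> rat) : 0 < n ->
  (\sum_(x < n) f (n %/ gcdn x n)%N =
   \sum_(d <- divisors n) (totient d)%:R * f d)%R.
Proof.
move=> n_gt0.
transitivity
  (\sum_(x < n) \sum_(d <- divisors n | (n %/ gcdn x n)%N == d) f d)%R.
  apply: eq_bigr => x _.
  have x_n : n %/ gcdn x n \in divisors n.
    by rewrite -dvdn_divisors // dvdn_div // dvdn_gcdr.
  rewrite big_mkcond (bigD1_seq _ x_n (divisors_uniq n)) /= eqxx big1 ?addr0 //.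
  by move=> d /negbTE; rewrite eq_sym => ->.
rewrite (exchange_big_dep predT) //= big_seq [RHS]big_seq; apply: eq_bigr => d.
rewrite -dvdn_divisors // => d_n; rewrite sumr_const mulr_natl.
by congr (_ *+ _)%R; apply: card_ord_gcdn.
Qed.

(** * Prime-by-prime formulas and the exponent of the unit group *)

(** Stated for any commutative monoid with unit 1, to serve both the product and the lcm; the
    hypothesis covers odd [n]. *)
Lemma big_primes_split2 (op : Monoid.com_law 1) n (F : nat -> nat) :
    (2 \notin primes n -> F 2 = 1) ->
  \big[op/1]_(p <- primes n) F p =
  op (F 2) (\big[op/1]_(p <- primes n | odd p) F p).
Proof.
move=> F2.
have podd p : p \in primes n -> odd p = (p != 2).
  rewrite mem_primes => /andP[p_pr _].
  by have [-> | /eqP p2] := p =P 2; last by case: (even_prime p_pr) p2 => // ->.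
have oddE : \big[op/1]_(p <- primes n | odd p) F p =
            \big[op/1]_(p <- primes n | p != 2) F p.
  rewrite big_seq_cond [RHS]big_seq_cond; apply: eq_bigl => p.
  by apply: andb_id2l => /podd.
have [n2 | n2] := boolP (2 \in primes n).
  by rewrite oddE (bigD1_seq 2) ?primes_uniq.
rewrite oddE F2 // Monoid.mul1m [RHS]big_seq_cond big_seq; apply: eq_bigl => p.
by apply/esym/andb_idr; apply: contraTneq => ->.
Qed.

Lemma totient_prod_primes n d : 0 < n -> d %| n ->
  totient d = \prod_(p <- primes n) totient (p ^ logn p d).
Proof.
move=> n_gt0 d_n; have d_gt0 := dvdn_gt0 n_gt0 d_n.
rewrite (bigID (mem (primes d))) /= [X in _ * X]big1 ?muln1; last first.
  by move=> p; rewrite -logn_gt0 lt0n negbK => /eqP ->.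
rewrite -big_filter (perm_big (primes d)) /=.
  rewrite totientE // big_seq [RHS]big_seq; apply: eq_bigr => p p_d.
  rewrite totient_pfactor ?logn_gt0 //.
  by move: p_d; rewrite mem_primes => /andP[].
apply: uniq_perm; rewrite ?filter_uniq ?primes_uniq // => p.
rewrite mem_filter andb_idr // !mem_primes d_gt0 n_gt0 => /and3P[-> _ /=].
by move/dvdn_trans; apply.
Qed.

(* For [d] dividing [n], the exponent of the unit group of [Z/d]; [n] only
   supplies a set of primes containing those of [d]. *)
Definition carmichael n d :=
  \big[lcmn/1]_(p <- primes n) pfactor_lambda p (logn p d).

Lemma carmichael_gt0 n d : 0 < carmichael n d.
Proof.
rewrite /carmichael big_seq; apply: (big_ind (fun x => 0 < x)) => //.
  by move=> x y; rewrite lcmn_gt0 => -> ->.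
move=> p; rewrite mem_primes => /andP[p_pr _].
rewrite /pfactor_lambda; case: eqP => _.
  by case: (logn p d) => [|[|[|m]]] //; rewrite lambda2SSS expn_gt0.
by rewrite totient_gt0 expn_gt0 prime_gt0.
Qed.

Lemma expn_carmichael_mod n d a : 0 < n -> d %| n -> coprime a n ->
  a ^ carmichael n d = 1 %[mod d].
Proof.
move=> n_gt0 d_n co_an; have d_gt0 := dvdn_gt0 n_gt0 d_n.
have [a0 | a_gt0] := posnP a.
  move: co_an d_n; rewrite a0 /coprime gcd0n => /eqP ->.
  by rewrite dvdn1 => /eqP ->; rewrite !modn1.
apply/eqP; rewrite eqn_mod_dvd ?expn_gt0 ?a_gt0 //.
apply/dvdn_partP => // p p_d; rewrite p_part.
have p_n : p \in primes n by apply: pi_of_dvd p_d.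
have p_pr : prime p by move: p_n; rewrite mem_primes => /andP[].
rewrite -eqn_mod_dvd ?expn_gt0 ?a_gt0 //; apply/eqP.
have /dvdnP[q ->] : pfactor_lambda p (logn p d) %| carmichael n d.
  by rewrite /carmichael (big_rem p) //= dvdn_lcml.
rewrite mulnC expnM -modnXm expn_pfactor_lambda_mod //.
  by rewrite modnXm exp1n.
by apply: coprime_dvdr co_an; move: p_n; rewrite mem_primes => /and3P[].
Qed.

Lemma carmichael_attained n : 0 < n ->
  exists2 a, coprime a n &
    forall d t, d %| n -> a ^ t = 1 %[mod d] -> carmichael n d %| t.
Proof.
move=> n_gt0.
(* Primes dividing [n] are at most [n], so a choice of [g] over a finite type suffices. *)
have /fin_all_exists[g gP] (p : 'I_n.+1) : exists g, prime p ->
    coprime g p /\ forall e t, e <= logn p n ->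
      g ^ t = 1 %[mod p ^ e] -> pfactor_lambda p e %| t.
  have [p_pr | //] := boolP (prime p).
    have [g co_g g_ord] := pfactor_lambda_attained (logn p n) p_pr.
    by exists g.
  by exists 0.
have [a aE] := chinese_primes (fun p => g (inord p)) (logn^~ n)
  (all_prime_primes n) (primes_uniq n).
have {gP} gP p : p \in primes n -> coprime a p /\
    forall e t, e <= logn p n ->
      a ^ t = 1 %[mod p ^ e] -> pfactor_lambda p e %| t.
  move=> p_n; have := p_n; rewrite mem_primes => /and3P[p_pr _ p_dvd].
  have pK : (inord p : 'I_n.+1) = p :> nat by rewrite inordK // ltnS dvdn_leq.
  have := gP (inord p); rewrite pK => /(_ p_pr)[co_g g_ord].
  have ga e : e <= logn p n -> a = g (inord p) %[mod p ^ e].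
    move=> /(dvdn_exp2l p) pe; rewrite -(modn_dvdm a pe) aE //.
    by rewrite modn_dvdm.
  split=> [|e t e_le]; last by rewrite -modnXm ga // modnXm; apply: g_ord.
  by rewrite -coprime_modl (ga 1) ?coprime_modl // logn_gt0.
exists a => [|d t d_n at1].
  rewrite /coprime eqn_leq gcdn_gt0 n_gt0 orbT andbT leqNgt.
  apply/negP => /pdiv_prime p_pr; set p := pdiv _ in p_pr.
  have p_g : p %| gcdn a n := pdiv_dvd _.
  have [|co_ap _] := gP p.
    by rewrite mem_primes p_pr n_gt0 (dvdn_trans p_g) // dvdn_gcdr.
  move: co_ap; rewrite coprime_sym prime_coprime // => /negP[].
  by rewrite (dvdn_trans p_g) // dvdn_gcdl.
rewrite /carmichael big_seq; apply: (big_ind (dvdn^~ t)) => [|x y xt yt|p p_n].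
- exact: dvd1n.
- by rewrite dvdn_lcm xt yt.
have [_ a_ord] := gP p p_n; apply: a_ord; first exact: dvdn_leq_log.
have pd : p ^ logn p d %| d by apply: pfactor_dvdnn.
by rewrite -(modn_dvdm _ pd) at1 modn_dvdm.
Qed.

(** * Extremal cycle numbers *)

Lemma linear_porbit_dvdn n a (s : {perm 'I_n}) :
    (forall x, val (s x) = (a * x) %% n) ->
  forall (x : 'I_n) k, (#|porbit s x| %| k) = (a ^ k == 1 %[mod n %/ gcdn x n]).
Proof.
move=> sE x k; rewrite -eqn_mod_mul2r ?(ord_gt0 x) // mul1n -iter_perm_fix.
by rewrite -val_eqE (iter_linear sE) [X in _ = (_ == X)]modn_small.
Qed.

Lemma linear_perm n a : coprime a n ->
  exists s : {perm 'I_n}, forall x, val (s x) = (a * x) %% n.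
Proof.
move=> co_an.
have f_inj : injective (fun x : 'I_n => Ordinal (ltn_pmod (a * x) (ord_gt0 x))).
  move=> x y /(congr1 val) /= /eqP; rewrite !(mulnC a) => xy.
  have n_gt0 := ord_gt0 x; have g1 : gcdn a n = 1 by apply/eqP.
  move: xy; rewrite eqn_mod_mul2r // g1 divn1 !modn_small // => /eqP.
  exact: val_inj.
by exists (perm f_inj) => x; rewrite permE.
Qed.

(* The number of cycles of [x |-> a x] for an optimal multiplier [a]. *)
Definition min_cyc n : rat :=
  (\sum_(x < n) (carmichael n (n %/ gcdn x n))%N%:R^-1)%R.

Lemma min_cyc_le n a (s : {perm 'I_n}) :
    (forall x, val (s x) = (a * x) %% n) -> coprime a n ->
  (min_cyc n <= (cyc s)%:R)%R.
Proof.
move=> sE co_an; rewrite /cyc card_porbits_sum; apply: ler_sum => x _.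
have n_gt0 := ord_gt0 x.
have o_gt0 : 0 < #|porbit s x| by rewrite lt0n card_porbit_neq0.
rewrite lef_pV2 ?posrE ?ltr0n ?carmichael_gt0 // ler_nat.
apply: dvdn_leq; first exact: carmichael_gt0.
rewrite (linear_porbit_dvdn sE) expn_carmichael_mod //.
by rewrite dvdn_div // dvdn_gcdr.
Qed.

Lemma min_cyc_attained n a (s : {perm 'I_n}) :
    (forall x, val (s x) = (a * x) %% n) -> coprime a n ->
    (forall d t, d %| n -> a ^ t = 1 %[mod d] -> carmichael n d %| t) ->
  (cyc s)%:R%R = min_cyc n.
Proof.
move=> sE co_an a_ord; rewrite /cyc card_porbits_sum; apply: eq_bigr => x _.
have n_gt0 := ord_gt0 x; have d_n : n %/ gcdn x n %| n.
  by rewrite dvdn_div // dvdn_gcdr.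
congr (_%:R^-1)%R; apply/eqP; rewrite eqn_dvd (linear_porbit_dvdn sE).
rewrite expn_carmichael_mod // eqxx /=; apply: a_ord => //; apply/eqP.
by rewrite -(linear_porbit_dvdn sE).
Qed.

Lemma bigminn_leq (I : eqType) (r : seq I) (F : I -> nat) m i :
  i \in r -> \big[minn/m]_(j <- r) F j <= F i.
Proof.
elim: r => // j r IHr; rewrite inE big_cons geq_min => /predU1P[-> | /IHr ->].
  by rewrite leqnn.
by rewrite orbT.
Qed.

Lemma affine_shift_linear n (s : {perm 'I_n}) : 0 < n -> affine s ->
  exists a b, coprime a n /\ forall x, val (shiftp s b x) = (a * x) %% n.
Proof.
move=> n_gt0 /existsP[a /existsP[c /andP[co_an /forallP sE]]].
(* Shifting by the preimage of 0 removes the constant term. *)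
pose b := (s^-1)%g (Ordinal n_gt0).
have sb : (a * b + c) %% n = 0 by rewrite -(eqP (sE b)) permKV.
exists a, b; split=> // x; rewrite permE /= (eqP (sE _)) /=.
by rewrite -modnDml modnMmr modnDml mulnDr -addnA -modnDmr sb addn0.
Qed.

(** Upper bound: every affine class contains a linear map, which has at least [min_cyc n] cycles.
    Lower bound: in the class of the optimal [s0], no member has more cycles than [s0]. *)
Lemma t_aff_min_cyc n : 0 < n -> ((t_aff n)%:R = n%:R - min_cyc n)%R.
Proof.
move=> n_gt0; have [a co_an a_ord] := carmichael_attained n_gt0.
have [s0 s0E] := linear_perm co_an.
have s0_cyc := min_cyc_attained s0E co_an a_ord.
have cyc_le (s : {perm 'I_n}) : cyc s <= n.
  by rewrite /cyc (leq_trans (leq_imset_card _ _)) // card_ord.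
rewrite -s0_cyc -natrB //; congr _%:R%R.
apply/eqP; rewrite eqn_leq; apply/andP; split.
  apply/bigmax_leqP => s s_aff.
  have [a' [b [co_a' sbE]]] := affine_shift_linear n_gt0 s_aff.
  apply: leq_trans (bigminn_leq _ _ (mem_index_enum b)) _; rewrite leq_sub2l //.
  by rewrite -(ler_nat rat) s0_cyc (min_cyc_le sbE).
have s0_aff : affine s0.
  have a_lt := ltn_pmod a n_gt0.
  apply/existsP; exists (Ordinal a_lt); apply/existsP; exists (Ordinal n_gt0).
  rewrite /= coprime_modl co_an; apply/forallP => x.
  by rewrite s0E addn0 modnMml.
apply: (leq_trans _ (leq_bigmax_cond _ s0_aff)).
rewrite /tclass; apply: (big_ind (leq (n - cyc s0))) => [|x y|b _].
- exact: leq_subr.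
- by rewrite leq_min => -> ->.
rewrite leq_sub2l //; apply: (leq_cyc_affine_linear (c := a * b) _ s0E) => x.
by rewrite permE /= s0E /= modnMmr mulnDr.
Qed.

Local Open Scope ring_scope.

(* The tuple (m_0,...,m_r), 0 <= m_i <= k_i, is encoded by the divisor
   d = 2^m_0 p_1^m_1 ... p_r^m_r of n, with m_0 = logn 2 d, m_i = logn p_i d;
   the p_i are the odd primes in primes n. *)
Theorem theorem3p4 (n : nat) (hn : (0 < n)%N) :
  ((t_aff n)%:R : rat) =
  n%:R - \sum_(d <- divisors n)
           ((totient (2 ^ logn 2 d) *
             \prod_(p <- primes n | odd p) totient (p ^ logn p d))%N%:R /
            (lcmn (lambda2 (logn 2 d))
                  (\big[lcmn/1%N]_(p <- primes n | odd p) totient (p ^ logn p d)))%:R).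
Proof.
rewrite t_aff_min_cyc //; congr (_ - _).
rewrite /min_cyc (@sum_ord_gcdn n (fun d => (carmichael n d)%:R^-1)) //.
rewrite big_seq [RHS]big_seq; apply: eq_bigr => d.
rewrite -dvdn_divisors // => d_n.
(* For odd [n] the factors at 2 are [totient 1] and [lambda2 0], both 1. *)
have log2 : 2 \notin primes n -> logn 2 d = 0%N.
  move=> n2; apply/eqP; rewrite -leqn0 leqNgt; apply: contra n2 => d2.
  by rewrite -logn_gt0 (leq_trans d2) // dvdn_leq_log.
congr (_%:R / _%:R).
  rewrite (totient_prod_primes hn d_n).
  by rewrite (@big_primes_split2 muln) // => /log2 ->.
rewrite /carmichael (@big_primes_split2 lcmn) => [|/log2 -> //].
congr lcmn; apply: eq_bigr => p p_odd; rewrite /pfactor_lambda.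
by case: eqP p_odd => // ->.
Qed.
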